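(* Assume that $\zeta=\{\zeta_n(r)\}_{n=0}^{\infty}$ belongs to $\mathcal F$. If $f(z)=\sum_{n=0}^{\infty}a_{pn+m}z^{pn+m}\in\mathcal B$, where $p\in\mathbb N$ and $0\le m\le p$, then: (i) we have $$\sum_{n=0}^{\infty}|a_{2np+m}|\zeta_{2n}(r^p)+\sum_{n=1}^{\infty}|a_{np+m}|^2\Big(\frac{\zeta_{2n}(r^p)}{1+|a_m|}+\sum_{k=n}^{\infty}\zeta_{2(k+1)}(r^p)\Big)\le|a_m|\zeta_0(r^p)+(1-|a_m|^2)\sum_{n=1}^{\infty}\zeta_{2n}(r^p)$$ for $r\in[0,1)$. The result is sharp. (ii) we have $$\sum_{n=1}^{\infty}|a_{(2n-1)p+m}|\zeta_{2n-1}(r^p)+\sum_{n=0}^{\infty}|a_{np+m}|^2\sum_{k=n}^{\infty}\zeta_{2k+1}(r^p)\le\sum_{n=1}^{\infty}\zeta_{2n-1}(r^p)$$ for $r\in[0,1)$. This result is sharp.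
   Context: $\mathbb D=\{z\in\mathbb C:|z|<1\}$. $\mathcal B$ is the class of analytic functions $f$ on $\mathbb D$ with $|f(z)|<1$ for all $z\in\mathbb D$. $\mathcal F$ is the set of all sequences $\{\zeta_n(r)\}_{n=0}^\infty$ of nonnegative continuous functions on $[0,1)$ such that $\sum_{n=0}^\infty\zeta_n(r)$ converges locally uniformly with respect to $r\in[0,1)$. Here $m$ is an integer. *)

(* Defs.v *)
(* Stdlib reals with Coquelicot (complex numbers, series). *)
From Stdlib Require Import Reals.
From Coquelicot Require Import Coquelicot.
Open Scope R_scope.

(* Analyticity on the unit disk is complex differentiability at each of its
   points. The values of [f] off the disk are irrelevant. *)
Definition classB (f : C -> C) : Prop :=
  forall z : C, Cmod z < 1 ->
    ex_derive (K := C_AbsRing) (V := C_NormedModule) f z /\ Cmod (f z) < 1.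

Definition unit_interval (r : R) : Prop := 0 <= r < 1.

(* [CVU_dom] compares the partial sums with their pointwise [Lim_seq], so it
   also gives the pointwise convergence of the series. *)
Definition classF (zeta : nat -> R -> R) : Prop :=
  (forall n, continuous_on unit_interval (zeta n)) /\
  (forall n r, unit_interval r -> 0 <= zeta n r) /\
  (forall r, unit_interval r ->
     exists delta : posreal,
       CVU_dom (fun n t => sum_n (fun k => zeta k t) n)
               (fun t => unit_interval t /\ Rabs (t - r) < delta)).

(* f(z) = sum_{n >= 0} a_{pn+m} z^{pn+m} on the unit disk; the values of [a]
   at indices not of the form pn+m play no role. *)
Definition has_expansion (p m : nat) (a : nat -> C) (f : C -> C) : Prop :=
  forall z : C, Cmod z < 1 ->
    is_series (K := C_AbsRing) (V := C_NormedModule)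
      (fun n => (a (p * n + m)%nat * z ^ (p * n + m)%nat)%C) (f z).

(* sum_{n >= n0} u n. [Series] is total, hence the separate convergence
   predicate. *)
Definition sum_from (n0 : nat) (u : nat -> R) : R :=
  Series (fun k => u (n0 + k)%nat).

Definition summable_from (n0 : nat) (u : nat -> R) : Prop :=
  ex_series (fun k => u (n0 + k)%nat).

(* In the terms below, [r] ranges over [0,1) and p >= 1, so r^p lies in [0,1)
   and the series involving [zeta] alone converge when [zeta] is in [classF]. *)

Definition even_lin (p m : nat) (zeta : nat -> R -> R) (a : nat -> C) (r : R)
    (n : nat) : R :=
  Cmod (a (2 * n * p + m)%nat) * zeta (2 * n)%nat (r ^ p).

Definition even_sq (p m : nat) (zeta : nat -> R -> R) (a : nat -> C) (r : R)
    (n : nat) : R :=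
  Cmod (a (n * p + m)%nat) ^ 2 *
  (zeta (2 * n)%nat (r ^ p) / (1 + Cmod (a m)) +
   sum_from n (fun k => zeta (2 * (k + 1))%nat (r ^ p))).

Definition even_lhs (p m : nat) (zeta : nat -> R -> R) (a : nat -> C) (r : R)
    : R :=
  sum_from 0 (even_lin p m zeta a r) + sum_from 1 (even_sq p m zeta a r).

Definition even_rhs (p m : nat) (zeta : nat -> R -> R) (a : nat -> C) (r : R)
    : R :=
  Cmod (a m) * zeta 0%nat (r ^ p) +
  (1 - Cmod (a m) ^ 2) * sum_from 1 (fun n => zeta (2 * n)%nat (r ^ p)).

(* The natural-number subtraction 2n-1 occurs only under n >= 1. *)
Definition odd_lin (p m : nat) (zeta : nat -> R -> R) (a : nat -> C) (r : R)
    (n : nat) : R :=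
  Cmod (a ((2 * n - 1) * p + m)%nat) * zeta (2 * n - 1)%nat (r ^ p).

Definition odd_sq (p m : nat) (zeta : nat -> R -> R) (a : nat -> C) (r : R)
    (n : nat) : R :=
  Cmod (a (n * p + m)%nat) ^ 2 *
  sum_from n (fun k => zeta (2 * k + 1)%nat (r ^ p)).

Definition odd_lhs (p m : nat) (zeta : nat -> R -> R) (a : nat -> C) (r : R)
    : R :=
  sum_from 1 (odd_lin p m zeta a r) + sum_from 0 (odd_sq p m zeta a r).

Definition odd_rhs (p : nat) (zeta : nat -> R -> R) (r : R) : R :=
  sum_from 1 (fun n => zeta (2 * n - 1)%nat (r ^ p)).

(* Main.v *)
Require Import Defs.
From Stdlib Require Import Reals Lra Lia.
From Coquelicot Require Import Coquelicot.
Open Scope R_scope.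

(* Put b_n = a_(pn+m), so that f(z) = z^m g(z^p) with g(w) = sum b_n w^n and
   |g| <= 1. If V is a polynomial then the N-th coefficient of g V^2 is at most
   the mean of |V|^2 over the unit circle, that is, the sum of the squared moduli
   of the coefficients of V. Choosing V(w) = 1 + sum_{k <= n} h_k w^(N-k) with
   N = 2n+1 or N = 2n and h_k a unimodular multiple of conj(b_k) (divided by
   1 + |b_0| when N = 2k) gives Carlson's inequalities
     |b_(2n+1)| + sum_{k <= n} |b_k|^2 <= 1,
     |b_(2n)| + sum_{k < n} |b_k|^2 + |b_n|^2 / (1 + |b_0|) <= 1.
   After interchanging the order of summation, the theorem is the sum of these
   with the weights zeta_(2n+1)(r^p) and zeta_(2n)(r^p). Equality holds throughout
   for z^m (alpha - z^p) / (1 - alpha z^p). *)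

(** * Finite sums of complex numbers *)

Definition csum (F : nat -> C) (n : nat) : C := sum_n (G := C_AbelianMonoid) F n.

Lemma csum_0 F : csum F 0 = F 0%nat.
Proof. apply (sum_O (G := C_AbelianMonoid)). Qed.

Lemma csum_S F n : csum F (S n) = (csum F n + F (S n))%C.
Proof. apply (sum_Sn (G := C_AbelianMonoid)). Qed.

Lemma csum_ext F G n :
  (forall k, (k <= n)%nat -> F k = G k) -> csum F n = csum G n.
Proof. apply (sum_n_ext_loc (G := C_AbelianMonoid)). Qed.

Lemma csum_plus F G n : csum (fun k => F k + G k)%C n = (csum F n + csum G n)%C.
Proof. apply (sum_n_plus (G := C_AbelianMonoid)). Qed.

Lemma csum_scal c F n : csum (fun k => c * F k)%C n = (c * csum F n)%C.
Proof. apply (sum_n_mult_l (K := C_Ring)). Qed.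

Lemma csum_switch (F : nat -> nat -> C) m n :
  csum (fun i => csum (F i) n) m = csum (fun j => csum (fun i => F i j) m) n.
Proof. apply (sum_n_switch (G := C_AbelianMonoid)). Qed.

Lemma csum_mult F G m n :
  (csum F m * csum G n)%C = csum (fun i => csum (fun j => F i * G j)%C n) m.
Proof.
rewrite Cmult_comm, <- csum_scal.
apply csum_ext; intros i _. rewrite csum_scal. apply Cmult_comm.
Qed.

Lemma csum_conj F n : Cconj (csum F n) = csum (fun k => Cconj (F k)) n.
Proof.
induction n as [|n IH].
- now rewrite !csum_0.
- now rewrite !csum_S, Cplus_conj, IH.
Qed.

Lemma csum_RtoC (F : nat -> R) n : csum (fun k => RtoC (F k)) n = RtoC (sum_n F n).
Proof.
induction n as [|n IH].
- now rewrite csum_0, sum_O.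
- now rewrite csum_S, sum_Sn, IH, <- RtoC_plus.
Qed.

Lemma csum_const c n : csum (fun _ => c) n = (INR (S n) * c)%C.
Proof.
induction n as [|n IH].
- rewrite csum_0. simpl INR. ring.
- rewrite csum_S, IH, (S_INR (S n)), RtoC_plus. ring.
Qed.

Lemma csum_zero (F : nat -> C) n :
  (forall k, (k <= n)%nat -> F k = 0) -> csum F n = 0.
Proof.
intros H. rewrite (csum_ext F (fun _ => RtoC 0) n H), csum_const. ring.
Qed.

Lemma csum_single (F : nat -> C) n l :
  (l <= n)%nat -> (forall k, (k <= n)%nat -> k <> l -> F k = 0) -> csum F n = F l.
Proof.
induction n as [|n IH]; intros Hl HF.
- rewrite csum_0. now replace l with 0%nat by lia.
- rewrite csum_S. destruct (Nat.eq_dec l (S n)) as [->|Hn].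
  + rewrite csum_zero by (intros k Hk; apply HF; lia). ring.
  + rewrite (HF (S n)), IH by (try intros k Hk Hkl; try apply HF; lia). ring.
Qed.

Lemma Cmod_csum_le F n : Cmod (csum F n) <= sum_n (fun k => Cmod (F k)) n.
Proof.
induction n as [|n IH].
- rewrite csum_0, sum_O. apply Rle_refl.
- rewrite csum_S, sum_Sn. eapply Rle_trans; [apply Cmod_triangle|].
  apply Rplus_le_compat_r, IH.
Qed.

Lemma sum_n_S (u : nat -> R) n : sum_n u (S n) = sum_n u n + u (S n).
Proof. apply (sum_Sn (G := R_AbelianMonoid)). Qed.

Lemma sum_n_nonneg (c : nat -> R) n : (forall k, 0 <= c k) -> 0 <= sum_n c n.
Proof. intros Hc. rewrite sum_n_Reals. now apply cond_pos_sum. Qed.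

(** * Points of the unit circle *)

Definition cis (t : R) : C := (cos t, sin t).

Lemma cis_plus s t : cis (s + t) = (cis s * cis t)%C.
Proof. unfold cis, Cmult; cbn. rewrite cos_plus, sin_plus. f_equal; ring. Qed.

Lemma cis_0 : cis 0 = 1.
Proof. unfold cis. now rewrite cos_0, sin_0. Qed.

Lemma cis_pow t n : (cis t ^ n)%C = cis (INR n * t).
Proof.
induction n as [|n IH].
- simpl. now rewrite Rmult_0_l, cis_0.
- rewrite Cpow_S, IH, <- cis_plus, S_INR. f_equal; ring.
Qed.

Lemma cis_conj t : Cconj (cis t) = cis (- t).
Proof. unfold cis, Cconj; cbn. now rewrite cos_neg, sin_neg. Qed.

Lemma Cmod_cis t : Cmod (cis t) = 1.
Proof.
unfold Cmod, cis; cbn.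
replace (cos t * (cos t * 1) + sin t * (sin t * 1)) with 1.
- apply sqrt_1.
- generalize (sin2_cos2 t). unfold Rsqr. lra.
Qed.

(** If cos x = 1, the half-angle formula cos x = 1 - 2 sin(x/2)^2 forces sin(x/2) = 0, which is
    impossible for x/2 strictly between -PI and PI and nonzero. *)
Lemma cis_neq_1 x : - (2 * PI) < x < 2 * PI -> x <> 0 -> cis x <> 1.
Proof.
intros Hx H0 H. assert (Hc : cos x = 1) by (now injection H).
assert (Hs : sin (x / 2) <> 0).
{ destruct (Rlt_dec 0 x).
  - apply Rgt_not_eq, sin_gt_0; lra.
  - apply Rlt_not_eq, sin_lt_0_var; lra. }
apply Hs. replace x with (2 * (x / 2)) in Hc by field.
rewrite cos_2a_sin in Hc. nra.
Qed.

(** * Geometric sums and means over roots of unity *)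

Lemma geometric_csum q n :
  ((1 - q) * csum (fun k => q ^ k)%C n)%C = (1 - q ^ S n)%C.
Proof.
induction n as [|n IH].
- rewrite csum_0. simpl. ring.
- rewrite csum_S. replace ((1 - q) * (csum (fun k => q ^ k) n + q ^ S n))%C
    with ((1 - q) * csum (fun k => q ^ k) n + (1 - q) * q ^ S n)%C by ring.
  rewrite IH. rewrite (Cpow_S q (S n)). ring.
Qed.

(* [M] is one less than the order of the roots of unity, since [sum_n] includes
   its upper bound. *)
Definition root (M k : nat) : C := cis (INR k * (2 * PI / INR (S M))).

Definition mean (M : nat) (F : C -> C) : C :=
  (/ INR (S M) * csum (fun k => F (root M k)) M)%C.

Lemma INR_S_neq_0 M : RtoC (INR (S M)) <> 0.
Proof. intros H. apply RtoC_inj in H. now apply (not_0_INR (S M)). Qed.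

Lemma mean_ext M F G :
  (forall t, F (cis t) = G (cis t)) -> mean M F = mean M G.
Proof. intros H. unfold mean. f_equal. apply csum_ext; intros; apply H. Qed.

Lemma mean_csum M (F : nat -> C -> C) n :
  mean M (fun w => csum (fun i => F i w) n) = csum (fun i => mean M (F i)) n.
Proof. unfold mean. now rewrite csum_switch, <- csum_scal. Qed.

Lemma mean_scal M c F : mean M (fun w => c * F w)%C = (c * mean M F)%C.
Proof. unfold mean. rewrite csum_scal. ring. Qed.

Lemma mean_plus M F G : mean M (fun w => F w + G w)%C = (mean M F + mean M G)%C.
Proof. unfold mean. rewrite csum_plus. ring. Qed.

(** Orthogonality of characters. At the k-th root the monomial equals q^k with q^(M+1) = 1, so its
    geometric sum vanishes unless q = 1. Since both exponents are at most M, |a - l| < M + 1, and q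
    = 1 happens only for a = l. *)
Lemma mean_monomial M a l : (a <= M)%nat -> (l <= M)%nat ->
  mean M (fun w => w ^ a * Cconj w ^ l)%C = if Nat.eq_dec a l then RtoC 1 else RtoC 0.
Proof.
intros Ha Hl. unfold mean.
assert (HM : 0 < INR (S M)) by (apply lt_0_INR; lia).
set (q := cis ((INR a - INR l) * (2 * PI / INR (S M)))).
rewrite (csum_ext _ (fun k => q ^ k)%C).
2:{ intros k _. unfold root, q. rewrite cis_conj, !cis_pow, <- cis_plus.
    f_equal. field. lra. }
destruct (Nat.eq_dec a l) as [->|Hal].
- assert (Hq : q = 1).
  { unfold q. rewrite Rminus_diag, Rmult_0_l. apply cis_0. }
  rewrite (csum_ext _ (fun _ => RtoC 1)), csum_const.
  + field. apply INR_S_neq_0.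
  + intros k _. rewrite Hq. apply Cpow_1_l.
- assert (Hq : q <> 1).
  { apply cis_neq_1.
    - assert (- INR (S M) < INR a - INR l < INR (S M)).
      { generalize (pos_INR a) (pos_INR l) (le_INR _ _ Ha) (le_INR _ _ Hl).
        rewrite S_INR. lra. }
      generalize PI_RGT_0; intro HP.
      assert (Hd : 0 < 2 * PI / INR (S M)) by (apply Rdiv_lt_0_compat; lra).
      assert (E : 2 * PI = INR (S M) * (2 * PI / INR (S M))) by (field; lra).
      set (d := 2 * PI / INR (S M)) in *. rewrite E.
      split; nra.
    - generalize PI_RGT_0; intro HP.
      apply Rmult_integral_contrapositive; split.
      + intros H. apply Hal, INR_eq. lra.
      + apply Rgt_not_eq, Rdiv_lt_0_compat; lra. }
  assert (HqM : (q ^ S M = 1)%C).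
  { unfold q. rewrite cis_pow.
    replace (INR (S M) * ((INR a - INR l) * (2 * PI / INR (S M))))
      with ((INR a - INR l) * (2 * PI)) by (field; lra).
    unfold cis.
    (* The periodicity lemmas take natural multiples of 2 PI, so the possibly negative a - l is
       split into two natural shifts. *)
    replace ((INR a - INR l) * (2 * PI))
      with ((0 + 2 * INR a * PI) - (0 + 2 * INR l * PI)) by ring.
    rewrite cos_minus, sin_minus, !cos_period, !sin_period, cos_0, sin_0.
    unfold RtoC. f_equal; ring. }
  assert (Hg := geometric_csum q M). rewrite HqM in Hg.
  assert (H1q : (1 - q <> 0)%C) by (apply Cminus_eq_contra; congruence).
  replace (csum (fun k => q ^ k)%C M) with (RtoC 0); [ring|].
  symmetry. replace (csum (fun k => q ^ k)%C M)
    with (/ (1 - q) * ((1 - q) * csum (fun k => q ^ k) M))%C by (field; exact H1q).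
  rewrite Hg. ring.
Qed.

Lemma Cmod_mean_le M K F (G : C -> R) :
  (forall t, Cmod (F (cis t)) <= K * G (cis t)) ->
  Cmod (mean M F) <= K * Re (mean M (fun w => RtoC (G w))).
Proof.
intros H. unfold mean.
assert (HM : 0 < / INR (S M)) by (apply Rinv_0_lt_compat, lt_0_INR; lia).
rewrite <- RtoC_inv by (apply not_0_INR; lia).
rewrite csum_RtoC, <- RtoC_mult, re_RtoC, Cmod_mult, Cmod_R.
rewrite (Rabs_pos_eq (/ INR (S M))) by lra.
replace (K * (/ INR (S M) * sum_n (fun k => G (root M k)) M))
  with (/ INR (S M) * (K * sum_n (fun k => G (root M k)) M)) by ring.
apply Rmult_le_compat_l; [lra|].
eapply Rle_trans; [apply Cmod_csum_le|].
rewrite <- (sum_n_mult_l (K := R_Ring) K).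
apply sum_n_m_le. intros k. apply H.
Qed.

(** * Coefficients of b V^2 on the unit circle *)

(** On the circle conj(w)^l acts as w^(-l), so only the term with j + a = l survives. The bound L +
    a <= M keeps every exponent in the range where the discrete mean separates monomials. *)
Lemma mean_poly_monomial M L (b : nat -> C) a l :
  (l <= L)%nat -> (L + a <= M)%nat ->
  mean M (fun w => w ^ a * (csum (fun j => b j * w ^ j) L * Cconj w ^ l))%C
    = if Compare_dec.le_dec a l then b (l - a)%nat else RtoC 0.
Proof.
intros Hl HM.
transitivity (csum (fun j => b j * (if Nat.eq_dec (j + a) l then 1 else 0))%C L).
- rewrite (mean_ext _ _
    (fun w => csum (fun j => b j * (w ^ (j + a) * Cconj w ^ l)) L))%C.
  + rewrite mean_csum. apply csum_ext; intros j Hj.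
    rewrite mean_scal, mean_monomial by lia. reflexivity.
  + intros t. set (w := cis t).
    transitivity (w ^ a * Cconj w ^ l * csum (fun j => b j * w ^ j) L)%C; [ring|].
    rewrite <- csum_scal.
    apply csum_ext; intros j _. rewrite Cpow_add_r. ring.
- destruct (Compare_dec.le_dec a l) as [Hal|Hal].
  + rewrite (csum_single _ _ (l - a)) by
      (try intros k Hk Hkl; try destruct (Nat.eq_dec _ _); try ring; lia).
    destruct (Nat.eq_dec _ _); [ring|lia].
  + apply csum_zero; intros k Hk.
    destruct (Nat.eq_dec _ _); [lia|ring].
Qed.

(** Parseval's identity: the exponents N - k with k <= n are pairwise distinct, and nonzero because
    n < N, hence also orthogonal to the constant term. *)
Lemma mean_Cmod2_lacunary M N n (h : nat -> C) :
  (n < N)%nat -> (N <= M)%nat ->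
  mean M (fun w => RtoC (Cmod (1 + csum (fun k => h k * w ^ (N - k)) n) ^ 2))%C
    = RtoC (1 + sum_n (fun k => Cmod (h k) ^ 2) n).
Proof.
intros Hn HM.
(* With S the sum over k, this expands |1 + S|^2 = 1 + S + conj(S) + S conj(S); the powers of
   exponent 0 give each term the shape of [mean_monomial]. *)
rewrite (mean_ext _ _ (fun w =>
   (w ^ 0 * Cconj w ^ 0 + csum (fun k => h k * (w ^ (N - k) * Cconj w ^ 0)) n)
   + (csum (fun k => Cconj (h k) * (w ^ 0 * Cconj w ^ (N - k))) n
   + csum (fun k => csum (fun l => h k * Cconj (h l) *
        (w ^ (N - k) * Cconj w ^ (N - l))) n) n)))%C.
- rewrite !mean_plus, !mean_csum, mean_monomial by lia.
  destruct (Nat.eq_dec 0 0) as [_|]; [|lia].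
  rewrite csum_zero, csum_zero.
  + rewrite RtoC_plus, <- csum_RtoC, Cplus_0_l, Cplus_0_r.
    f_equal. apply csum_ext; intros k Hk.
    rewrite mean_csum, (csum_single _ _ k Hk).
    * rewrite mean_scal, mean_monomial by lia.
      destruct (Nat.eq_dec _ _); [|lia]. rewrite Cmod2_conj. ring.
    * intros l Hl Hlk. rewrite mean_scal, mean_monomial by lia.
      destruct (Nat.eq_dec _ _); [lia|ring].
  + intros k Hk. rewrite mean_scal, mean_monomial by lia.
    destruct (Nat.eq_dec _ _); [lia|ring].
  + intros k Hk. rewrite mean_scal, mean_monomial by lia.
    destruct (Nat.eq_dec _ _); [lia|ring].
- intros t. rewrite Cmod2_conj, Cplus_conj, csum_conj.
  set (w := cis t).
  replace (csum (fun k => csum _ n) n) with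
    (csum (fun k => h k * w ^ (N - k))%C n *
     csum (fun k => Cconj (h k * w ^ (N - k))) n)%C.
  2:{ rewrite csum_mult. apply csum_ext; intros k _.
      apply csum_ext; intros l _. rewrite Cmult_conj, Cpow_conj. ring. }
  rewrite (csum_ext (fun k => h k * (w ^ (N - k) * Cconj w ^ 0))%C
     (fun k => h k * w ^ (N - k))%C) by (intros; simpl; ring).
  rewrite (csum_ext (fun k => Cconj (h k) * (w ^ 0 * Cconj w ^ (N - k)))%C
     (fun k => Cconj (h k * w ^ (N - k)))).
  2:{ intros; rewrite Cmult_conj, Cpow_conj; simpl; ring. }
  replace (Cconj 1) with (RtoC 1) by (unfold Cconj, RtoC; cbn; f_equal; ring).
  simpl Cpow. ring.
Qed.

(* The left-hand side is the N-th coefficient of b(w) V(w)^2, where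
   V(w) = 1 + sum_{k <= n} h_k w^(N-k). *)
Lemma lacunary_square_bound_circle (b h : nat -> C) L N n K :
  (2 * n <= N)%nat -> (n < N)%nat -> (N <= L)%nat ->
  (forall t, Cmod (csum (fun j => b j * cis t ^ j) L)%C <= K) ->
  Cmod (b N + 2 * csum (fun k => h k * b k) n
        + (if Nat.eq_dec N (2 * n) then b 0%nat * (h n * h n) else 0))%C
    <= K * (1 + sum_n (fun k => Cmod (h k) ^ 2) n).
Proof.
intros H2n HnN HNL HK.
set (M := (L + 2 * N)%nat).
(* The factor conj(w)^N moves the N-th coefficient to the constant term, which the mean extracts. It
   has modulus one, so it does not affect the estimate. *)
set (SX := fun w : C => (csum (fun j => b j * w ^ j) L * Cconj w ^ N)%C).
set (V := fun w : C => (1 + csum (fun k => h k * w ^ (N - k)) n)%C).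
replace (b N + _ + _)%C with (mean M (fun w => SX w * (V w * V w)))%C.
- rewrite <- (re_RtoC (1 + _)), <- (mean_Cmod2_lacunary M N n h HnN) by (unfold M; lia).
  apply (Cmod_mean_le M K _ (fun w => Cmod (V w) ^ 2)). intros t.
  rewrite <- !Cmod_pow. unfold SX. rewrite !Cmod_mult, !Cmod_pow, Cmod_conj, Cmod_cis, pow1.
  replace (Cmod (V (cis t)) ^ 2) with (Cmod (V (cis t)) * Cmod (V (cis t))) by ring.
  rewrite Rmult_1_r. apply Rmult_le_compat_r; [|apply HK].
  generalize (Cmod_ge_0 (V (cis t))); nra.
- rewrite (mean_ext _ _ (fun w =>
     w ^ 0 * SX w + 2 * csum (fun k => h k * (w ^ (N - k) * SX w)) n
     + csum (fun k => csum (fun l => h k * h l *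
         (w ^ ((N - k) + (N - l)) * SX w)) n) n))%C.
  + rewrite !mean_plus, mean_scal, !mean_csum. unfold SX at 1.
    rewrite mean_poly_monomial by (unfold M; lia).
    destruct (Compare_dec.le_dec 0 N) as [_|]; [|lia].
    rewrite Nat.sub_0_r. f_equal; [f_equal; f_equal|].
    * apply csum_ext; intros k Hk. rewrite mean_scal. unfold SX.
      rewrite mean_poly_monomial by (unfold M; lia).
      destruct (Compare_dec.le_dec (N - k) N) as [_|]; [|lia].
      do 2 f_equal. lia.
    (* A product of two terms of V contributes only if (N - k) + (N - l) <= N, that is k + l >= N.
       As k + l <= 2n <= N, only k = l = n with N = 2n remains. *)
    * assert (Hkl : forall k l, (k <= n)%nat -> (l <= n)%nat ->
        mean M (fun w => h k * h l * (w ^ (N - k + (N - l)) * SX w))%C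
        = if Compare_dec.le_dec (N - k + (N - l)) N
          then (h k * h l * b (N - (N - k + (N - l)))%nat)%C else RtoC 0).
      { intros k l Hk Hl. rewrite mean_scal. unfold SX.
        rewrite mean_poly_monomial by (unfold M; lia).
        destruct (Compare_dec.le_dec _ _); ring. }
      destruct (Nat.eq_dec N (2 * n)) as [HN|HN].
      -- rewrite (csum_single _ _ n) by
           (try intros k Hk Hkn; rewrite ?mean_csum; try apply csum_zero;
            try intros l Hl; rewrite ?Hkl by lia;
            try destruct (Compare_dec.le_dec _ _); try lia; reflexivity).
         rewrite mean_csum, (csum_single _ _ n) by
           (try intros l Hl Hln; rewrite ?Hkl by lia;
            try destruct (Compare_dec.le_dec _ _); try lia; reflexivity).
         rewrite Hkl by lia. destruct (Compare_dec.le_dec _ _); [|lia].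
         replace (N - (N - n + (N - n)))%nat with 0%nat by lia. ring.
      -- apply csum_zero; intros k Hk. rewrite mean_csum.
         apply csum_zero; intros l Hl. rewrite Hkl by lia.
         destruct (Compare_dec.le_dec _ _); [lia|reflexivity].
  + intros t. set (w := cis t).
    replace (csum (fun k => csum _ n) n) with
      (csum (fun k => h k * w ^ (N - k))%C n *
       csum (fun k => h k * w ^ (N - k))%C n * SX w)%C.
    2:{ rewrite csum_mult, Cmult_comm, <- csum_scal. apply csum_ext; intros k _.
        rewrite <- csum_scal.
        apply csum_ext; intros l _. rewrite Cpow_add_r. ring. }
    rewrite (csum_ext (fun k => h k * (w ^ (N - k) * SX w))%C
      (fun k => SX w * (h k * w ^ (N - k)))%C) by (intros; ring).
    rewrite csum_scal. unfold V. simpl Cpow. ring.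
Qed.

(** * Carlson's coefficient inequalities *)

Lemma is_series_C (a : nat -> C) (l : C) :
  is_series (K := C_AbsRing) (V := C_NormedModule) a l <->
  (forall eps, 0 < eps ->
     exists N, forall n, (N <= n)%nat -> Cmod (csum a n - l)%C < eps).
Proof.
unfold is_series.
rewrite (filterlim_locally_ball_norm (K := C_AbsRing) (U := C_NormedModule)).
split.
- intros H eps Heps. exact (H (mkposreal eps Heps)).
- intros H [eps Heps]. exact (H eps Heps).
Qed.

Lemma sum_n_nonneg_le_Series (u : nat -> R) n :
  (forall k, 0 <= u k) -> ex_series u -> sum_n u n <= Series u.
Proof.
intros Hu Hex. apply Series_correct in Hex.
apply (is_lim_seq_incr_compare (sum_n u)); [exact Hex|].
intros k. rewrite sum_n_S. generalize (Hu (S k)); lra.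
Qed.

Lemma Cmod_csum_diff_le (F : nat -> C) (c : nat -> R) L d :
  (forall k, Cmod (F k) <= c k) ->
  Cmod (csum F (L + d) - csum F L)%C <= sum_n c (L + d) - sum_n c L.
Proof.
intros H. induction d as [|d IH].
- rewrite Nat.add_0_r. unfold Cminus. rewrite Cplus_opp_r, Cmod_0. lra.
- rewrite Nat.add_succ_r, csum_S, sum_n_S.
  replace (csum F (L + d) + F (S (L + d)) - csum F L)%C
    with ((csum F (L + d) - csum F L) + F (S (L + d)))%C by ring.
  eapply Rle_trans; [apply Cmod_triangle|]. generalize (H (S (L + d))). lra.
Qed.

(** Abel's lemma: convergence at a larger radius [rho'] bounds the terms there, and passing to rho
    gains a geometric factor with ratio rho / [rho']. *)
Lemma expansion_abs_summable p m a f rho :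
  (1 <= p)%nat -> has_expansion p m a f -> 0 < rho < 1 ->
  ex_series (fun n => Cmod (a (p * n + m)%nat) * rho ^ (p * n + m)).
Proof.
intros Hp Hf Hrho.
set (rho' := (1 + rho) / 2).
assert (Hrho' : rho < rho' < 1) by (unfold rho'; lra).
assert (Hz : Cmod (RtoC rho') < 1) by (rewrite Cmod_R, Rabs_pos_eq; lra).
specialize (Hf _ Hz). rewrite is_series_C in Hf.
destruct (Hf (1 / 2) ltac:(lra)) as [N HN].
apply (ex_series_incr_n _ (S N)).
apply (ex_series_le (K := R_AbsRing) (V := R_CompleteNormedModule) _
  (fun n => (rho / rho') ^ n)).
2:{ apply ex_series_geom. rewrite Rabs_pos_eq.
    - apply Rlt_div_l; lra.
    - apply Rdiv_le_0_compat; lra. }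
intros n. set (k := (S N + n)%nat). set (e := (p * k + m)%nat).
change (norm ?x) with (Rabs x).
rewrite Rabs_pos_eq by
  (apply Rmult_le_pos; [apply Cmod_ge_0|apply pow_le; lra]).
(* The term is the difference of two consecutive partial sums, both within 1/2 of the limit. *)
assert (Hterm : Cmod (a e) * rho' ^ e <= 1).
{ assert (H1 := HN (N + n)%nat ltac:(lia)). assert (H2 := HN k ltac:(unfold k; lia)).
  replace (Cmod (a e) * rho' ^ e) with (Cmod (a e * RtoC rho' ^ e)%C).
  2:{ rewrite Cmod_mult, Cmod_pow, Cmod_R, (Rabs_pos_eq rho') by lra. reflexivity. }
  unfold k in H2. rewrite Nat.add_succ_l, csum_S in H2.
  fold k in H2. change (S (N + n)) with k in H2. fold e in H2.
  set (S0 := csum _ _) in *. set (T := (a e * _)%C) in *.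
  replace T with ((S0 + T - f rho') + - (S0 - f rho'))%C by ring.
  eapply Rle_trans; [apply Cmod_triangle|]. rewrite Cmod_opp. lra. }
replace (Cmod (a e) * rho ^ e) with (Cmod (a e) * rho' ^ e * (rho / rho') ^ e).
2:{ unfold Rdiv. rewrite Rpow_mult_distr, pow_inv by lra. field.
    apply pow_nonzero; lra. }
assert (Hq : 0 <= rho / rho' <= 1).
{ split; [apply Rdiv_le_0_compat; lra|apply Rle_div_l; lra]. }
assert (Hle : (n <= e)%nat) by (unfold e, k; nia).
replace ((rho / rho') ^ e) with ((rho / rho') ^ n * (rho / rho') ^ (e - n))
  by (rewrite <- pow_add; f_equal; lia).
assert (H1 := pow_le (rho / rho') n (proj1 Hq)).
assert (H2 := pow_le (rho / rho') (e - n) (proj1 Hq)).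
assert (H3 : (rho / rho') ^ (e - n) <= 1).
{ rewrite <- (pow1 (e - n)). apply pow_incr; lra. }
assert (H4 : 0 <= Cmod (a e) * rho' ^ e).
{ apply Rmult_le_pos; [apply Cmod_ge_0|apply pow_le; lra]. }
set (x := (rho / rho') ^ n) in *. set (y := (rho / rho') ^ (e - n)) in *.
set (c := Cmod (a e) * rho' ^ e) in *.
assert (c * y <= 1) by nra.
replace (c * (x * y)) with (x * (c * y)) by ring. nra.
Qed.

(* The point w = rho^p e^(it) has the p-th root z = rho e^(it/p), and the
   partial sums at z differ from those below by the unimodular factor
   e^(imt/p). *)
Lemma truncation_bound p m a f rho N eps :
  (1 <= p)%nat -> classB f -> has_expansion p m a f -> 0 < rho < 1 -> 0 < eps ->
  exists L, (N <= L)%nat /\ forall t,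
    Cmod (csum (fun j => (a (p * j + m)%nat * RtoC (rho ^ (p * j + m)))
                         * cis t ^ j) L)%C <= 1 + eps.
Proof.
intros Hp HB Hf Hrho Heps.
(* This majorant does not depend on t, so a single L serves the whole circle. *)
set (c := fun n => Cmod (a (p * n + m)%nat) * rho ^ (p * n + m)).
assert (Hc : ex_series c) by (eapply expansion_abs_summable; eauto).
assert (Hc0 : forall n, 0 <= c n).
{ intros n. apply Rmult_le_pos; [apply Cmod_ge_0|apply pow_le; lra]. }
assert (Hlim : is_lim_seq (sum_n c) (Series c)) by exact (Series_correct _ Hc).
apply is_lim_seq_spec in Hlim.
destruct (Hlim (mkposreal (eps / 2) ltac:(lra))) as [L0 HL0].
cbn [pos] in HL0.
exists (max N L0). split; [lia|]. intros t. set (L := max N L0).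
set (F := fun j => _).
set (z := (RtoC rho * cis (t / INR p))%C).
assert (Hz : Cmod z < 1).
{ unfold z. rewrite Cmod_mult, Cmod_cis, Cmod_R, Rabs_pos_eq; lra. }
destruct (HB z Hz) as [_ Hfz]. specialize (Hf z Hz). rewrite is_series_C in Hf.
(* Here [N1] depends on t; the terms between L and L + [N1] are then controlled by the tail of [c],
   uniformly in t. *)
destruct (Hf (eps / 2) ltac:(lra)) as [N1 HN1].
specialize (HN1 (L + N1)%nat ltac:(lia)).
assert (Hcsum : csum (fun n => a (p * n + m)%nat * z ^ (p * n + m))%C (L + N1)
  = (cis (t / INR p) ^ m * csum F (L + N1))%C).
{ rewrite <- csum_scal. apply csum_ext; intros j _. unfold F, z.
  rewrite Cpow_mult_l, <- RtoC_pow, Cpow_add_r, Cpow_mult_r, (cis_pow _ p).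
  replace (INR p * (t / INR p)) with t by (field; apply not_0_INR; lia). ring. }
rewrite Hcsum in HN1.
assert (HF : Cmod (csum F (L + N1)) <= 1 + eps / 2).
{ replace (Cmod (csum F (L + N1)))
    with (Cmod (cis (t / INR p) ^ m * csum F (L + N1))%C)
    by (rewrite Cmod_mult, Cmod_pow, Cmod_cis, pow1; ring).
  set (T := (cis (t / INR p) ^ m * csum F (L + N1))%C) in *.
  replace T with ((T - f z) + f z)%C by ring.
  eapply Rle_trans; [apply Cmod_triangle|]. lra. }
assert (Hd : Cmod (csum F (L + N1) - csum F L)%C <= eps / 2).
{ eapply Rle_trans; [apply (Cmod_csum_diff_le F c)|].
  - intros k. unfold F, c. rewrite !Cmod_mult, Cmod_pow, Cmod_cis, pow1, Cmod_R.
    rewrite Rabs_pos_eq by (apply pow_le; lra). lra.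
  - generalize (sum_n_nonneg_le_Series c (L + N1) Hc0 Hc).
    specialize (HL0 L ltac:(lia)). apply Rabs_def2 in HL0. lra. }
replace (csum F L) with (csum F (L + N1) + - (csum F (L + N1) - csum F L))%C by ring.
eapply Rle_trans; [apply Cmod_triangle|]. rewrite Cmod_opp. lra.
Qed.

(** Bernoulli's inequality, used to make the limit rho -> 1 explicit. *)
Lemma pow_lower_bound d k : 0 <= d <= 1 -> 1 - INR k * d <= (1 - d) ^ k.
Proof.
intros Hd. induction k as [|k IH].
- simpl. lra.
- rewrite S_INR, <- tech_pow_Rmult.
  assert (0 <= INR k * d) by (apply Rmult_le_pos; [apply pos_INR|lra]).
  assert (Hp := pow_le (1 - d) k ltac:(lra)). nra.
Qed.

Lemma le_of_pow_mult_le x y k :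
  0 <= y -> (forall rho, 0 < rho < 1 -> rho ^ k * x <= y) -> x <= y.
Proof.
intros Hy H. destruct (Rle_lt_dec x y) as [Hxy|Hxy]; [exact Hxy|exfalso].
assert (HK := pos_INR k).
(* With this d one has k d x < (x - y) / 2, so Bernoulli's inequality gives (1 - d)^k x > y,
   contradicting the hypothesis at rho = 1 - d. *)
set (d := (x - y) / (2 * (INR k + 1) * x)).
assert (Hden : 0 < 2 * (INR k + 1) * x) by nra.
assert (Hd : 0 < d) by (apply Rdiv_lt_0_compat; lra).
assert (Hdx : d * (2 * (INR k + 1) * x) = x - y) by (unfold d; field; nra).
assert (Hd1 : d < 1) by (apply Rlt_div_l; nra).
assert (H1 := H (1 - d) ltac:(lra)).
assert (H2 := pow_lower_bound d k ltac:(lra)).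
nra.
Qed.

(** The circle estimate is applied to the coefficients dilated by rho, whose truncations are bounded
    by nearly 1; then the error eps tends to 0 and rho to 1. *)
Lemma lacunary_square_bound p m a f (h : nat -> C) N n :
  (1 <= p)%nat -> classB f -> has_expansion p m a f ->
  (2 * n <= N)%nat -> (n < N)%nat ->
  Cmod (a (p * N + m)%nat + 2 * csum (fun k => h k * a (p * k + m)%nat) n
        + (if Nat.eq_dec N (2 * n) then a m * (h n * h n) else 0))%C
    <= 1 + sum_n (fun k => Cmod (h k) ^ 2) n.
Proof.
intros Hp HB Hf H2n HnN.
set (X := (_ + _ + _)%C). set (Y := 1 + _).
assert (HY : 0 < Y).
{ unfold Y. generalize (sum_n_nonneg _ n (fun k => pow2_ge_0 (Cmod (h k)))). lra. }
apply (le_of_pow_mult_le _ _ (p * N + m)); [lra|]. intros rho Hrho.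
apply le_epsilon. intros eps Heps.
assert (He : 0 < eps / Y) by (apply Rdiv_lt_0_compat; lra).
destruct (truncation_bound p m a f rho N (eps / Y) Hp HB Hf Hrho He) as [L [HNL HL]].
(* These weights make every term on the left carry the same factor rho^(pN+m), the square term
   included because 2(N - n) = N there. They are no larger than [h], so the right-hand side does not
   grow. *)
pose (h' := fun k => (h k * RtoC (rho ^ (p * (N - k))))%C).
assert (Hkey := lacunary_square_bound_circle
  (fun j => a (p * j + m)%nat * RtoC (rho ^ (p * j + m)))%C h' L N n _ H2n HnN HNL HL).
cbv beta in Hkey.
replace (_ + _ + _)%C with (RtoC (rho ^ (p * N + m)) * X)%C in Hkey.
- rewrite Cmod_mult, Cmod_R, Rabs_pos_eq in Hkey by (apply pow_le; lra).
  eapply Rle_trans; [exact Hkey|].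
  replace (Y + eps) with ((1 + eps / Y) * Y) by (field; lra).
  apply Rmult_le_compat_l; [lra|]. unfold Y. apply Rplus_le_compat_l.
  apply sum_n_m_le. intros k. unfold h'.
  rewrite Cmod_mult, Rpow_mult_distr, Cmod_R.
  assert (H0 : 0 <= rho ^ (p * (N - k))) by (apply pow_le; lra).
  assert (H1 : rho ^ (p * (N - k)) <= 1).
  { rewrite <- (pow1 (p * (N - k))). apply pow_incr; lra. }
  rewrite Rabs_pos_eq by exact H0.
  assert (H2 := pow2_ge_0 (Cmod (h k))).
  rewrite <- (Rmult_1_r (Cmod (h k) ^ 2)) at 2.
  apply Rmult_le_compat_l; [exact H2|nra].
- unfold X.
  rewrite (csum_ext (fun k => h' k * _)%C
    (fun k => RtoC (rho ^ (p * N + m)) * (h k * a (p * k + m)%nat))%C).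
  + rewrite csum_scal. destruct (Nat.eq_dec N (2 * n)) as [HN|HN]; [|ring].
    unfold h'. rewrite Nat.mul_0_r, Nat.add_0_l.
    rewrite !RtoC_pow, !Cpow_add_r.
    replace (RtoC rho ^ (p * N))%C
      with (RtoC rho ^ (p * (N - n)) * RtoC rho ^ (p * (N - n)))%C
      by (rewrite <- Cpow_add_r; f_equal; nia).
    ring.
  + intros k Hk. unfold h'.
    replace (rho ^ (p * N + m)) with (rho ^ (p * (N - k)) * rho ^ (p * k + m))
      by (rewrite <- pow_add; f_equal; nia).
    rewrite RtoC_mult. ring.
Qed.

Lemma polar_unit z : exists u, Cmod u = 1 /\ z = (u * RtoC (Cmod z))%C.
Proof.
destruct (Req_dec (Cmod z) 0) as [H0|H0].
- exists 1. rewrite Cmod_1, H0, (Cmod_eq_0 z H0). split; [reflexivity|ring].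
- exists (z / Cmod z)%C.
  assert (RtoC (Cmod z) <> 0) by (intros H; apply RtoC_inj in H; auto).
  split.
  + rewrite Cmod_div, Cmod_R, Rabs_pos_eq by (auto using Cmod_ge_0). field; auto.
  + field; auto.
Qed.

Lemma carlson_odd p m a f n :
  (1 <= p)%nat -> classB f -> has_expansion p m a f ->
  Cmod (a (p * (2 * n + 1) + m)%nat)
    + sum_n (fun k => Cmod (a (p * k + m)%nat) ^ 2) n <= 1.
Proof.
intros Hp HB Hf.
set (N := (2 * n + 1)%nat).
destruct (polar_unit (a (p * N + m)%nat)) as [u [Hu HbN]].
assert (H := lacunary_square_bound p m a f
  (fun k => u * Cconj (a (p * k + m)%nat))%C N n Hp HB Hf
  ltac:(unfold N; lia) ltac:(unfold N; lia)).
destruct (Nat.eq_dec N (2 * n)) as [HN|_]; [unfold N in HN; lia|].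
cbv beta in H.
set (s := sum_n (fun k => Cmod (a (p * k + m)%nat) ^ 2) n).
rewrite (sum_n_ext _ (fun k => Cmod (a (p * k + m)%nat) ^ 2)) in H
  by (intros; rewrite Cmod_mult, Hu, Cmod_conj, Rmult_1_l; reflexivity).
fold s in H.
rewrite (csum_ext _ (fun k => u * RtoC (Cmod (a (p * k + m)%nat) ^ 2))%C) in H
  by (intros; rewrite Cmod2_conj; ring).
rewrite csum_scal, csum_RtoC in H. fold s in H.
assert (Hs : 0 <= s).
{ apply sum_n_nonneg. intros; apply pow2_ge_0. }
set (beta := Cmod (a (p * N + m)%nat)) in *.
assert (Hb : 0 <= beta) by apply Cmod_ge_0.
(* All terms share the phase u, so the left side is beta + 2s; against 1 + s this leaves beta + s <=
   1. *)
replace (_ + _ + _)%C with (u * RtoC (beta + 2 * s))%C in H.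
- rewrite Cmod_mult, Hu, Cmod_R, Rabs_pos_eq in H by lra. lra.
- rewrite HbN, RtoC_plus, RtoC_mult. ring.
Qed.

Lemma carlson_even p m a f n :
  (1 <= p)%nat -> classB f -> has_expansion p m a f ->
  Cmod (a (p * (2 * S n) + m)%nat)
    + sum_n (fun k => Cmod (a (p * k + m)%nat) ^ 2) n
    + Cmod (a (p * S n + m)%nat) ^ 2 / (1 + Cmod (a m)) <= 1.
Proof.
intros Hp HB Hf.
set (N := (2 * S n)%nat).
set (a0 := Cmod (a m)).
assert (Ha0 : 0 <= a0) by apply Cmod_ge_0.
destruct (polar_unit (a (p * N + m)%nat)) as [u [Hu HbN]].
(* A factor g in the last weight yields a net gain of 2 q^2 g - (1 + |b_0|) q^2 g^2, where q is the
   modulus of the last coefficient. It is largest at g = 1 / (1 + |b_0|), with value q^2 / (1 +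
   |b_0|). *)
pose (h := fun k => (u * Cconj (a (p * k + m)%nat) *
  RtoC (if Nat.eq_dec k (S n) then / (1 + a0) else 1))%C).
assert (H := lacunary_square_bound p m a f h N (S n) Hp HB Hf
  ltac:(unfold N; lia) ltac:(unfold N; lia)).
destruct (Nat.eq_dec N (2 * S n)) as [_|HN]; [|unfold N in HN; lia].
rewrite csum_S, sum_n_S in H.
set (s := sum_n (fun k => Cmod (a (p * k + m)%nat) ^ 2) n).
rewrite (sum_n_ext_loc _ (fun k => Cmod (a (p * k + m)%nat) ^ 2)) in H.
2:{ intros k Hk. unfold h. destruct (Nat.eq_dec k (S n)); [lia|].
    rewrite !Cmod_mult, Hu, Cmod_conj, Cmod_1, Rmult_1_l, Rmult_1_r. reflexivity. }
fold s in H.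
rewrite (csum_ext _ (fun k => u * RtoC (Cmod (a (p * k + m)%nat) ^ 2))%C) in H.
2:{ intros k Hk. unfold h. destruct (Nat.eq_dec k (S n)); [lia|].
    rewrite Cmod2_conj. ring. }
rewrite csum_scal, csum_RtoC in H. fold s in H.
unfold h in H. destruct (Nat.eq_dec (S n) (S n)) as [_|]; [|lia].
assert (Hs : 0 <= s).
{ apply sum_n_nonneg. intros; apply pow2_ge_0. }
set (beta := Cmod (a (p * N + m)%nat)) in *.
assert (Hb : 0 <= beta) by apply Cmod_ge_0.
set (bn := a (p * S n + m)%nat) in *.
set (g := / (1 + a0)) in *.
assert (Hg : 0 < g) by (apply Rinv_0_lt_compat; lra).
assert (Hga : g * (1 + a0) = 1) by (unfold g; field; lra).
rewrite !Cmod_mult, Hu, Cmod_conj, Cmod_R, (Rabs_pos_eq g), Rmult_1_l in H by lra.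
set (q := Cmod bn) in *.
assert (Hq : 0 <= q) by apply Cmod_ge_0.
(* The phase of this term need not agree with u, so it is moved to the other side at the cost of its
   modulus. *)
set (E := (a m * (u * Cconj bn * g * (u * Cconj bn * g)))%C) in *.
assert (HE : Cmod E = a0 * (q * g) ^ 2).
{ unfold E. rewrite !Cmod_mult, Hu, Cmod_conj, Cmod_R, (Rabs_pos_eq g) by lra.
  fold q a0. ring. }
set (D := beta + 2 * s + 2 * (q ^ 2 * g)).
assert (HD : Cmod (u * RtoC D)%C = D).
{ rewrite Cmod_mult, Hu, Cmod_R, Rabs_pos_eq; [ring|]. unfold D. nra. }
match type of H with Cmod ?Z <= _ => assert (HZ : (u * RtoC D = Z + - E)%C) end.
{ rewrite HbN. unfold D, q. rewrite !RtoC_plus, !RtoC_mult, Cmod2_conj. ring. }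
assert (H2 := Cmod_triangle (a (p * N + m)%nat
  + 2 * (u * s + u * Cconj bn * g * bn) + E)%C (- E)%C).
rewrite <- HZ, HD, Cmod_opp, HE in H2.
unfold Rdiv. fold g. fold beta q s. unfold D in H2.
change (Cmod (a m)) with a0. fold g.
assert (Hqg : a0 * (q * g) ^ 2 + (q * g) ^ 2 = q ^ 2 * g).
{ replace (a0 * (q * g) ^ 2 + (q * g) ^ 2) with (q ^ 2 * g * (g * (1 + a0))) by ring.
  rewrite Hga. ring. }
replace (q * g * (q * g * 1)) with ((q * g) ^ 2) in H by ring.
lra.
Qed.

(** * Rearrangement of the series *)

Lemma classF_ex_series zeta t :
  classF zeta -> unit_interval t -> ex_series (fun n => zeta n t).
Proof.
intros [_ [_ Hcv]] Ht. destruct (Hcv t Ht) as [delta Hd].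
exists (real (Lim_seq (fun n => sum_n (fun k => zeta k t) n))).
apply (is_lim_seq_spec _ (Finite _)). intros eps.
destruct (Hd eps) as [N HN]. exists N. intros n Hn. apply (HN n Hn).
split; [exact Ht|]. rewrite Rminus_diag, Rabs_R0. apply cond_pos.
Qed.

(** By nonnegativity the partial sums along the progression increase and are dominated by those of
    the full series. *)
Lemma ex_series_step2 (u : nat -> R) d :
  (forall n, 0 <= u n) -> ex_series u -> ex_series (fun k => u (2 * k + d)%nat).
Proof.
intros Hu Hex.
assert (Hle : forall K, sum_n (fun k => u (2 * k + d)%nat) K <= sum_n u (2 * K + d)).
{ induction K as [|K IH].
  - rewrite sum_O. change (2 * 0 + d)%nat with d. destruct d as [|d].
    + rewrite sum_O. lra.
    + rewrite sum_n_S. generalize (sum_n_nonneg u d Hu). lra.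
  - rewrite sum_n_S. replace (2 * S K + d)%nat with (S (S (2 * K + d))) by lia.
    rewrite !sum_n_S. generalize (Hu (S (2 * K + d))). lra. }
apply (ex_finite_lim_seq_incr (sum_n (fun k => u (2 * k + d)%nat)) (Series u)).
- intros n. rewrite sum_n_S. generalize (Hu (2 * S n + d)%nat). lra.
- intros n. eapply Rle_trans; [apply Hle|]. now apply sum_n_nonneg_le_Series.
Qed.

Lemma ex_series_mult_bounded (e s : nat -> R) :
  (forall n, 0 <= e n) -> ex_series e -> (forall n, 0 <= s n <= 1) ->
  ex_series (fun n => e n * s n).
Proof.
intros He Hex Hs.
apply (ex_series_le (K := R_AbsRing) (V := R_CompleteNormedModule) _ e);
  [|exact Hex].
intros n. change (norm ?x) with (Rabs x).
rewrite Rabs_pos_eq; generalize (He n) (Hs n); nra.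
Qed.

(** Interchange of summation over the triangle n <= k. Summation by parts leaves a boundary term, a
    partial sum of [c] times a tail of [e]; the former is at most 1 and the latter tends to 0. *)
Lemma is_series_weighted_tails (c e : nat -> R) :
  (forall n, 0 <= c n) -> (forall n, sum_n c n <= 1) ->
  (forall n, 0 <= e n) -> ex_series e ->
  is_series (fun n => c n * Series (fun k => e (n + k)%nat))
            (Series (fun n => e n * sum_n c n)).
Proof.
intros Hc Hc1 He Hex.
set (tau := fun n => Series (fun k => e (n + k)%nat)).
assert (Htau : forall n, tau n = e n + tau (S n)).
{ intros n. unfold tau. rewrite Series_incr_1.
  - rewrite Nat.add_0_r. f_equal. apply Series_ext. intros k. f_equal. lia.
  - now apply ex_series_incr_n. }
assert (Htau_lim : is_lim_seq (fun n => tau (S n)) 0).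
{ apply (is_lim_seq_ext (fun n => Series e - sum_n e n)).
  - induction n as [|n IH].
    + rewrite sum_O. change (Series e) with (tau 0%nat). rewrite (Htau 0%nat). ring.
    + rewrite sum_n_S. generalize (Htau (S n)). lra.
  - replace (Finite 0) with (Finite (Series e - Series e))
      by (f_equal; apply Rminus_diag).
    apply is_lim_seq_minus'; [apply is_lim_seq_const|].
    exact (Series_correct e Hex). }
(* Abel summation *)
assert (Hsum : forall K, sum_n (fun n => e n * sum_n c n) K + sum_n c K * tau (S K)
                         = sum_n (fun n => c n * tau n) K).
{ induction K as [|K IH].
  - rewrite !sum_O, (Htau 0%nat). ring.
  - rewrite !sum_n_S, <- IH, (Htau (S K)). ring. }
assert (Hex' : ex_series (fun n => e n * sum_n c n)).
{ apply ex_series_mult_bounded; auto. intros n. split; [now apply sum_n_nonneg|auto]. }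
change (is_lim_seq (sum_n (fun n => c n * tau n)) (Series (fun n => e n * sum_n c n))).
apply (is_lim_seq_ext _ _ _ Hsum).
rewrite <- (Rplus_0_r (Series _)).
apply is_lim_seq_plus'; [exact (Series_correct _ Hex')|].
apply (is_lim_seq_le_le (fun _ => 0) _ (fun n => tau (S n)));
  [|apply is_lim_seq_const|exact Htau_lim].
intros n. assert (0 <= tau (S n)).
{ eapply Rle_trans; [apply (He (S n + 0)%nat)|].
  rewrite <- (sum_O (fun k => e (S n + k)%nat)).
  apply sum_n_nonneg_le_Series; [intros; apply He|now apply ex_series_incr_n]. }
generalize (Hc1 n) (sum_n_nonneg c n Hc). nra.
Qed.

(** Removing the diagonal k = n from the previous interchange subtracts e_n c_n from both series. *)
Lemma is_series_weighted_strict_tails (c e : nat -> R) :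
  (forall n, 0 <= c n) -> (forall n, sum_n c n <= 1) ->
  (forall n, 0 <= e n) -> ex_series e ->
  is_series (fun n => c n * Series (fun k => e (S n + k)%nat))
            (Series (fun n => e n * (sum_n c n - c n))).
Proof.
intros Hc Hc1 He Hex.
assert (Hcle : forall n, c n <= sum_n c n).
{ intros [|n]; [rewrite sum_O; lra|]. rewrite sum_n_S.
  generalize (sum_n_nonneg c n Hc). lra. }
assert (H1 : ex_series (fun n => e n * sum_n c n)).
{ apply ex_series_mult_bounded; auto. intros n. split; [now apply sum_n_nonneg|auto]. }
assert (H2 : ex_series (fun n => e n * c n)).
{ apply ex_series_mult_bounded; auto. intros n. generalize (Hc n) (Hcle n) (Hc1 n); lra. }
rewrite (Series_ext _ (fun n => e n * sum_n c n - e n * c n)) by (intros; ring).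
rewrite Series_minus by assumption.
apply (is_series_ext (fun n => c n * Series (fun k => e (n + k)%nat) - e n * c n)).
- intros n. rewrite (Series_incr_1 (fun k => e (n + k)%nat)).
  + rewrite Nat.add_0_r.
    rewrite (Series_ext (fun k => e (n + S k)%nat) (fun k => e (S n + k)%nat))
      by (intros; f_equal; lia).
    (* [ring] does not see through the carrier of [R_AbelianMonoid]. *)
    refine (_ : @eq R _ _). ring.
  + now apply ex_series_incr_n.
- apply (is_series_minus (V := R_NormedModule)).
  + now apply is_series_weighted_tails.
  + now apply Series_correct.
Qed.

Definition abs_coef (p m : nat) (a : nat -> C) (n : nat) : R :=
  Cmod (a (p * n + m)%nat).

Lemma abs_coef_bounds p m a n :
  (forall n, sum_n (fun k => abs_coef p m a k ^ 2) n <= 1) ->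
  0 <= abs_coef p m a n <= 1.
Proof.
intros HB1. set (B := abs_coef p m a) in *.
assert (H0 : 0 <= B n) by apply Cmod_ge_0. split; [exact H0|].
assert (H1 : B n ^ 2 <= sum_n (fun k => B k ^ 2) n).
{ destruct n as [|n]; [rewrite sum_O; lra|]. rewrite sum_n_S.
  generalize (sum_n_nonneg (fun k => B k ^ 2) n (fun k => pow2_ge_0 _)). lra. }
generalize (HB1 n). nra.
Qed.

(** Collecting everything that multiplies a given zeta_(2j+1) produces exactly the left-hand side of
    Carlson's odd inequality. *)
Lemma odd_lhs_series (p m : nat) (zeta : nat -> R -> R) (a : nat -> C) (r : R)
  (B := abs_coef p m a) (sqsum := fun n => sum_n (fun k => B k ^ 2) n)
  (z := fun n => zeta n (r ^ p)) :
  (forall n, 0 <= z n) -> ex_series z -> (forall n, sqsum n <= 1) ->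
  summable_from 1 (odd_lin p m zeta a r) /\
  summable_from 0 (odd_sq p m zeta a r) /\
  odd_lhs p m zeta a r
    = Series (fun j => z (2 * j + 1)%nat * (B (2 * j + 1)%nat + sqsum j)) /\
  ex_series (fun j => z (2 * j + 1)%nat).
Proof.
intros Hz0 Hz HB1. assert (HBb := fun n => abs_coef_bounds p m a n HB1). fold B in HBb.
set (e := fun j => z (2 * j + 1)%nat).
assert (He0 : forall j, 0 <= e j) by (intros; apply Hz0).
assert (He : ex_series e) by now apply ex_series_step2.
set (lin := fun j => e j * B (2 * j + 1)%nat).
assert (Hlin : ex_series lin).
{ apply ex_series_mult_bounded; [exact He0|exact He|intros; apply HBb]. }
assert (Hs : ex_series (fun j => e j * sqsum j)).
{ apply ex_series_mult_bounded; auto. intros n. split; [|apply HB1].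
  apply sum_n_nonneg. intros; apply pow2_ge_0. }
assert (Hsq := is_series_weighted_tails (fun k => B k ^ 2) e
  (fun k => pow2_ge_0 _) HB1 He0 He).
assert (Elin : forall k, lin k = odd_lin p m zeta a r (1 + k)).
{ intros k. unfold lin, e, odd_lin, B, abs_coef, z.
  replace (2 * (1 + k) - 1)%nat with (2 * k + 1)%nat by lia.
  rewrite (Nat.mul_comm (2 * k + 1) p). ring. }
assert (Esq : forall k, B k ^ 2 * Series (fun l => e (k + l)%nat)
                        = odd_sq p m zeta a r (0 + k)).
{ intros k. unfold odd_sq, sum_from, B, abs_coef. simpl (0 + k)%nat.
  now rewrite (Nat.mul_comm k p). }
split; [|split; [|split; [|exact He]]].
- now apply (ex_series_ext lin).
- eexists. apply (is_series_ext _ _ _ Esq Hsq).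
- unfold odd_lhs, sum_from.
  rewrite <- (Series_ext _ _ Elin), <- (Series_ext _ _ Esq).
  rewrite (is_series_unique _ _ Hsq), <- Series_plus by assumption.
  apply Series_ext. intros j. unfold lin, e, sqsum. ring.
Qed.

(** Collecting by the weight zeta_(2j+2) gives the bracket of Carlson's even inequality without
    |b_0|^2, since the squares start at n = 1. The weight zeta_0 meets only the linear term
    |b_0|. *)
Lemma even_lhs_series (p m : nat) (zeta : nat -> R -> R) (a : nat -> C) (r : R)
  (B := abs_coef p m a) (sqsum := fun n => sum_n (fun k => B k ^ 2) n)
  (z := fun n => zeta n (r ^ p)) :
  (forall n, 0 <= z n) -> ex_series z -> (forall n, sqsum n <= 1) ->
  summable_from 0 (even_lin p m zeta a r) /\
  summable_from 1 (even_sq p m zeta a r) /\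
  even_lhs p m zeta a r
    = B 0%nat * z 0%nat +
      Series (fun j => z (2 * S j)%nat *
        (B (2 * S j)%nat + B (S j) ^ 2 / (1 + B 0%nat) + (sqsum j - B 0%nat ^ 2))) /\
  ex_series (fun j => z (2 * S j)%nat).
Proof.
intros Hz0 Hz HB1. assert (HBb := fun n => abs_coef_bounds p m a n HB1). fold B in HBb.
set (e := fun j => z (2 * S j)%nat).
assert (He0 : forall j, 0 <= e j) by (intros; apply Hz0).
assert (He : ex_series e).
{ apply (ex_series_ext (fun j => z (2 * j + 2)%nat)).
  - intros j. unfold e. f_equal. lia.
  - now apply ex_series_step2. }
set (lin := fun j => z (2 * j)%nat * B (2 * j)%nat).
assert (Hlin : ex_series lin).
{ apply (ex_series_mult_bounded (fun j => z (2 * j)%nat));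
    [intros; apply Hz0| |intros; apply HBb].
   apply (ex_series_ext (fun j => z (2 * j + 0)%nat)).
    + intros j. f_equal. lia.
    + now apply ex_series_step2. }
set (c := fun k => B (S k) ^ 2).
assert (Hc0 : forall k, 0 <= c k) by (intros; apply pow2_ge_0).
assert (Hshift : forall n, sum_n c n = sqsum n + B (S n) ^ 2 - B 0%nat ^ 2).
{ unfold sqsum. induction n as [|n IH].
  - rewrite !sum_O. unfold c. refine (_ : @eq R _ _). ring.
  - rewrite !sum_n_S, IH. unfold c. refine (_ : @eq R _ _). ring. }
assert (Hc1 : forall n, sum_n c n <= 1).
{ intros n. rewrite Hshift. generalize (HB1 (S n)) (pow2_ge_0 (B 0%nat)).
  unfold sqsum. rewrite sum_n_S. lra. }
assert (Hdiag : ex_series (fun j => e j * (c j / (1 + B 0%nat)))).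
{ apply ex_series_mult_bounded; auto. intros n.
  assert (H1 := proj1 (HBb 0%nat)). assert (H2 := HBb (S n)).
  unfold c. split; [apply Rdiv_le_0_compat; nra|apply Rle_div_l; nra]. }
assert (Htail : ex_series (fun j => e j * (sum_n c j - c j))).
{ apply ex_series_mult_bounded; auto. intros n. rewrite Hshift.
  replace (sqsum n + B (S n) ^ 2 - B 0%nat ^ 2 - c n) with (sqsum n - B 0%nat ^ 2)
    by (unfold c; ring).
  split.
  - destruct n as [|n]; [unfold sqsum; rewrite sum_O; lra|].
    generalize (Hshift n) (sum_n_nonneg c n Hc0).
    unfold sqsum. rewrite sum_n_S. lra.
  - generalize (HB1 n) (pow2_ge_0 (B 0%nat)). lra. }
assert (Hsq := is_series_plus (V := R_NormedModule) _ _ _ _ (Series_correct _ Hdiag)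
  (is_series_weighted_strict_tails c e Hc0 Hc1 He0 He)).
assert (Elin : forall k, lin k = even_lin p m zeta a r (0 + k)).
{ intros k. unfold lin, even_lin, B, abs_coef, z. simpl (0 + k)%nat.
  rewrite (Nat.mul_comm (2 * k) p). ring. }
(* The square with index k + 1 has its diagonal weight e_k in the quotient, while its inner sum
   starts at e_(k+1); hence the strict tails. *)
assert (Esq : forall k,
  e k * (c k / (1 + B 0%nat)) + c k * Series (fun l => e (S k + l)%nat)
    = even_sq p m zeta a r (1 + k)).
{ intros k. unfold even_sq, sum_from, c, B, abs_coef. simpl (1 + k)%nat.
  rewrite (Nat.mul_comm (S k) p), Nat.mul_0_r, Nat.add_0_l.
  rewrite (Series_ext (fun l => zeta (2 * (S k + l + 1))%nat (r ^ p))
     (fun l => e (S k + l)%nat)).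
  2:{ intros l. unfold e, z. f_equal. lia. }
  unfold e at 1, z. field. generalize (Cmod_ge_0 (a m)). lra. }
split; [|split; [|split; [|exact He]]].
- now apply (ex_series_ext lin).
- eexists. apply (is_series_ext _ _ _ Esq Hsq).
- unfold even_lhs, sum_from.
  rewrite <- (Series_ext _ _ Elin), <- (Series_ext _ _ Esq).
  assert (HsqU : Series (fun k =>
      e k * (c k / (1 + B 0%nat)) + c k * Series (fun l => e (S k + l)%nat))
    = Series (fun j => e j * (c j / (1 + B 0%nat)))
      + Series (fun j => e j * (sum_n c j - c j)))
    by exact (is_series_unique _ _ Hsq).
  rewrite HsqU, (Series_incr_1 lin) by assumption.
  assert (Hlin' : ex_series (fun k => lin (S k))) 
    by exact (proj1 (ex_series_incr_1 lin) Hlin).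
  rewrite <- (Series_plus _ _ Hdiag Htail), Rplus_assoc.
  rewrite <- Series_plus; [|exact Hlin'|exact (ex_series_plus _ _ Hdiag Htail)].
  f_equal; [unfold lin; simpl; ring|].
  apply Series_ext. intros j. rewrite Hshift. unfold lin, e, c. field.
  generalize (proj1 (HBb 0%nat)). lra.
Qed.

(** * The extremal function *)

Definition cdiff (f : C -> C) (z : C) : Prop :=
  ex_derive (K := C_AbsRing) (V := C_NormedModule) f z.

(* [C_NormedModule] carries the product uniform structure, whereas the library's
   product rule is stated over [AbsRing_NormedModule C_AbsRing]. *)
Lemma is_derive_C_AbsRing (f : C -> C) (z l : C) :
  is_derive (K := C_AbsRing) (V := C_NormedModule) f z l <->
  is_derive (K := C_AbsRing) (V := AbsRing_NormedModule C_AbsRing) f z l.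
Proof.
split; intros [_ H]; (split; [apply is_linear_scal_l|exact H]).
Qed.

Lemma cdiff_mult f g z :
  cdiff f z -> cdiff g z -> cdiff (fun w => f w * g w)%C z.
Proof.
intros [df Hf] [dg Hg].
apply is_derive_C_AbsRing in Hf. apply is_derive_C_AbsRing in Hg.
eexists. apply is_derive_C_AbsRing.
exact (is_derive_mult (K := C_AbsRing) f g z df dg Hf Hg Cmult_comm).
Qed.

Lemma cdiff_const c z : cdiff (fun _ => c) z.
Proof. apply ex_derive_const. Qed.

Lemma cdiff_id z : cdiff (fun w => w) z.
Proof. exists (RtoC 1). apply is_derive_C_AbsRing.
exact (is_derive_id (K := C_AbsRing) z). Qed.

Lemma cdiff_minus f g z :
  cdiff f z -> cdiff g z -> cdiff (fun w => f w - g w)%C z.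
Proof. apply (ex_derive_minus (K := C_AbsRing) (V := C_NormedModule)). Qed.

Lemma cdiff_pow f n z : cdiff f z -> cdiff (fun w => f w ^ n)%C z.
Proof.
intros Hf. induction n as [|n IH].
- exact (cdiff_const 1 z).
- exact (cdiff_mult _ _ z Hf IH).
Qed.

Lemma is_derive_Cinv (x : C) : x <> 0 ->
  is_derive (K := C_AbsRing) (V := C_NormedModule) Cinv x (- / (x * x))%C.
Proof.
intros Hx. split.
- apply (is_linear_scal_l (K := C_AbsRing) (V := C_NormedModule)).
- intros y Hy.
  apply (is_filter_lim_locally_unique (K := C_AbsRing) (V := AbsRing_NormedModule C_AbsRing)) in Hy.
  subst y. intros [eps Heps]. cbn [pos].
  assert (H0 : 0 < Cmod x) by now apply Cmod_gt_0.
  set (k := Cmod x) in *.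
  (* The first bound keeps |y| >= |x| / 2. The second makes |y - x| / (|x|^2 |y|), the remainder
     divided by |y - x|, at most eps. *)
  assert (Hd : 0 < Rmin (k / 2) (eps * k ^ 3 / 2)).
  { apply Rmin_glb_lt; [lra|]. apply Rdiv_lt_0_compat; [|lra].
    apply Rmult_lt_0_compat; [exact Heps|now apply pow_lt]. }
  exists (mkposreal _ Hd). intros y Hy.
  change (Cmod (y - x)%C < Rmin (k / 2) (eps * k ^ 3 / 2)) in Hy.
  change (Cmod ((/ y - / x) - ((y - x) * - / (x * x)))%C <= eps * Cmod (y - x)%C).
  assert (H1 := Rmin_l (k / 2) (eps * k ^ 3 / 2)).
  assert (H2 := Rmin_r (k / 2) (eps * k ^ 3 / 2)).
  assert (Hyk : k / 2 <= Cmod y).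
  { assert (H3 := Cmod_triangle y (x - y)%C).
    replace (y + (x - y))%C with x in H3 by ring.
    replace (x - y)%C with (- (y - x))%C in H3 by ring.
    rewrite Cmod_opp in H3. fold k in H3. lra. }
  assert (Hy0 : y <> RtoC 0) by (apply Cmod_gt_0; lra).
  replace (/ y - / x - (y - x) * - / (x * x))%C
    with ((y - x) * ((y - x) / (x * x * y)))%C by (field; auto).
  rewrite Cmod_mult, Rmult_comm. apply Rmult_le_compat_r; [apply Cmod_ge_0|].
  rewrite Cmod_div, !Cmod_mult by (repeat apply Cmult_neq_0; auto). fold k.
  apply Rle_div_l; [repeat apply Rmult_lt_0_compat; lra|].
  apply Rle_trans with (eps * k ^ 3 / 2); [lra|].
  replace (eps * k ^ 3 / 2) with (eps * (k * k * (k / 2))) by field.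
  apply Rmult_le_compat_l; [lra|]. apply Rmult_le_compat_l; nra.
Qed.

Lemma cdiff_inv (f : C -> C) z : f z <> 0 -> cdiff f z -> cdiff (fun w => / f w)%C z.
Proof.
intros H0 [df Hf]. apply is_derive_C_AbsRing in Hf. eexists.
exact (is_derive_comp (K := C_AbsRing) (V := C_NormedModule) Cinv f z _ df
  (is_derive_Cinv _ H0) Hf).
Qed.

Definition extremal (p m : nat) (alpha : R) (z : C) : C :=
  (z ^ m * ((alpha - z ^ p) * / (1 - alpha * z ^ p)))%C.

(** Taylor coefficients at 0 of the Blaschke factor (alpha - w) / (1 - alpha w). *)
Definition blaschke_coef (alpha : R) (n : nat) : R :=
  match n with O => alpha | S k => - ((1 - alpha ^ 2) * alpha ^ k) end.

Definition extremal_coef (p m : nat) (alpha : R) (k : nat) : C :=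
  RtoC (blaschke_coef alpha ((k - m) / p)).

Lemma extremal_coefE p m alpha n : (1 <= p)%nat ->
  extremal_coef p m alpha (p * n + m) = RtoC (blaschke_coef alpha n).
Proof.
intros Hp. unfold extremal_coef. do 2 f_equal.
rewrite Nat.add_sub, Nat.mul_comm. apply Nat.div_mul. lia.
Qed.

Lemma Cmod_lt_1_neq q : Cmod q < 1 -> (1 - q <> 0)%C.
Proof.
intros Hq H. replace q with (RtoC 1) in Hq.
- rewrite Cmod_1 in Hq. lra.
- replace q with (1 - (1 - q))%C by ring. rewrite H. ring.
Qed.

Lemma Cmod_scaled_lt_1 alpha w :
  0 <= alpha < 1 -> Cmod w < 1 -> Cmod (alpha * w)%C < 1.
Proof.
intros Ha Hw. rewrite Cmod_mult, Cmod_R, Rabs_pos_eq by lra.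
generalize (Cmod_ge_0 w). nra.
Qed.

(** This rests on the identity |1 - alpha w|^2 - |alpha - w|^2 = (1 - alpha^2)(1 - |w|^2). *)
Lemma Cmod_blaschke_lt_1 alpha w : 0 <= alpha < 1 -> Cmod w < 1 ->
  Cmod ((alpha - w) * / (1 - alpha * w))%C < 1.
Proof.
intros Ha Hw.
assert (Hden := Cmod_lt_1_neq _ (Cmod_scaled_lt_1 _ _ Ha Hw)).
rewrite Cmod_mult, Cmod_inv by exact Hden.
assert (Hpos : 0 < Cmod (1 - alpha * w)%C) by now apply Cmod_gt_0.
apply Rlt_div_l; [exact Hpos|]. rewrite Rmult_1_l.
apply Rsqr_incrst_0; [|apply Cmod_ge_0|lra].
rewrite !Rsqr_pow2, !Cmod2_alt.
assert (Hw2 : Cmod w ^ 2 < 1) by (generalize (Cmod_ge_0 w); nra).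
rewrite Cmod2_alt in Hw2. destruct w as [x y].
unfold Re, Im, Cminus, Cplus, Copp, Cmult, RtoC in *; cbn [fst snd] in *.
apply Rlt_0_minus.
match goal with |- 0 < ?e =>
  replace e with ((1 - alpha ^ 2) * (1 - (x ^ 2 + y ^ 2))) by ring end.
apply Rmult_lt_0_compat; nra.
Qed.

Lemma classB_extremal p m alpha :
  (1 <= p)%nat -> 0 <= alpha < 1 -> classB (extremal p m alpha).
Proof.
intros Hp Ha z Hz.
assert (Hw : Cmod (z ^ p)%C < 1).
{ rewrite Cmod_pow. apply pow_lt_1_compat; [split; [apply Cmod_ge_0|exact Hz]|lia]. }
split.
- change (cdiff (extremal p m alpha) z). unfold extremal.
  apply cdiff_mult; [apply cdiff_pow, cdiff_id|].
  apply cdiff_mult.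
  + apply cdiff_minus; [apply cdiff_const|apply cdiff_pow, cdiff_id].
  + apply (cdiff_inv (fun z => 1 - alpha * z ^ p)%C).
    * apply Cmod_lt_1_neq. now apply Cmod_scaled_lt_1.
    * apply cdiff_minus; [apply cdiff_const|].
      apply cdiff_mult; [apply cdiff_const|apply cdiff_pow, cdiff_id].
- unfold extremal. rewrite Cmod_mult, Cmod_pow.
  assert (H1 := Cmod_blaschke_lt_1 _ _ Ha Hw).
  assert (H2 : Cmod z ^ m <= 1).
  { rewrite <- (pow1 m). apply pow_incr. split; [apply Cmod_ge_0|lra]. }
  assert (H3 := pow_le (Cmod z) m (Cmod_ge_0 z)).
  assert (H4 := Cmod_ge_0 ((alpha - z ^ p) * / (1 - alpha * z ^ p))%C). nra.
Qed.

(** Multiplying by the denominator makes the sum telescope and gives the remainder in closed form;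
    it tends to 0 when |w| < 1 and 0 <= alpha < 1. *)
Lemma csum_blaschke (alpha : R) (w : C) n :
  ((1 - alpha * w) * csum (fun k => blaschke_coef alpha k * w ^ k) n)%C
    = (alpha - w + (1 - alpha ^ 2) * (alpha ^ n * w ^ S n))%C.
Proof.
induction n as [|n IH].
- rewrite csum_0. unfold blaschke_coef. simpl Cpow. ring.
- rewrite csum_S.
  replace ((1 - alpha * w) * (csum (fun k => blaschke_coef alpha k * w ^ k) n
             + blaschke_coef alpha (S n) * w ^ S n))%C
    with ((1 - alpha * w) * csum (fun k => blaschke_coef alpha k * w ^ k) n
          + (1 - alpha * w) * (blaschke_coef alpha (S n) * w ^ S n))%C by ring.
  rewrite IH. unfold blaschke_coef.
  rewrite RtoC_opp, RtoC_mult, RtoC_minus, !RtoC_pow, (Cpow_S alpha n), (Cpow_S w (S n)).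
  ring.
Qed.

Lemma has_expansion_extremal p m alpha :
  (1 <= p)%nat -> 0 <= alpha < 1 ->
  has_expansion p m (extremal_coef p m alpha) (extremal p m alpha).
Proof.
intros Hp Ha z Hz. apply is_series_C. intros eps Heps.
set (w := (z ^ p)%C).
assert (Hw : Cmod w < 1).
{ unfold w. rewrite Cmod_pow.
  apply pow_lt_1_compat; [split; [apply Cmod_ge_0|exact Hz]|lia]. }
assert (Hden := Cmod_lt_1_neq _ (Cmod_scaled_lt_1 _ _ Ha Hw)).
(* The error after n terms is exactly c alpha^n w^(n+1). *)
set (c := (z ^ m * (1 - alpha ^ 2) * / (1 - alpha * w))%C).
destruct (pow_lt_1_zero (Cmod w) ltac:(rewrite Rabs_pos_eq; [exact Hw|apply Cmod_ge_0])
  (eps / (Cmod c + 1))) as [N HN].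
{ apply Rdiv_lt_0_compat; [exact Heps|generalize (Cmod_ge_0 c); lra]. }
exists N. intros n Hn.
replace (csum _ n - _)%C with (c * (alpha ^ n * w ^ S n))%C.
- specialize (HN (S n) ltac:(lia)).
  rewrite Rabs_pos_eq in HN by (apply pow_le, Cmod_ge_0).
  rewrite !Cmod_mult, !Cmod_pow, Cmod_R, (Rabs_pos_eq alpha) by lra.
  assert (Hc := Cmod_ge_0 c).
  apply Rlt_div_r in HN; [|lra].
  assert (H1 : alpha ^ n <= 1) by (rewrite <- (pow1 n); apply pow_incr; lra).
  assert (H2 : 0 <= alpha ^ n) by (apply pow_le; lra).
  assert (H3 : 0 <= Cmod w ^ S n) by (apply pow_le, Cmod_ge_0).
  set (x := Cmod w ^ S n) in *. set (y := alpha ^ n) in *.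
  assert (y * x <= x) by nra. nra.
- rewrite (csum_ext _ (fun k => z ^ m * (blaschke_coef alpha k * w ^ k))%C).
  + rewrite csum_scal. unfold extremal. fold w.
    replace (csum (fun k => blaschke_coef alpha k * w ^ k)%C n)
      with (/ (1 - alpha * w) *
        ((1 - alpha * w) * csum (fun k => blaschke_coef alpha k * w ^ k) n))%C
      by (field; exact Hden).
    rewrite csum_blaschke. unfold c. ring.
  + intros k _. rewrite extremal_coefE, Cpow_add_r, Cpow_mult_r by exact Hp.
    fold w. ring.
Qed.

Lemma abs_coef_extremal p m alpha n : (1 <= p)%nat -> 0 <= alpha < 1 ->
  abs_coef p m (extremal_coef p m alpha) n
    = match n with O => alpha | S k => (1 - alpha ^ 2) * alpha ^ k end.
Proof.
intros Hp Ha. unfold abs_coef. rewrite extremal_coefE, Cmod_R by exact Hp.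
destruct n as [|k]; unfold blaschke_coef.
- apply Rabs_pos_eq; lra.
- rewrite Rabs_Ropp. apply Rabs_pos_eq. apply Rmult_le_pos; [nra|apply pow_le; lra].
Qed.

(** Each step adds (1 - alpha^2)^2 alpha^(2n) = (1 - alpha^2)(alpha^(2n) - alpha^(2n+2)), so the sum
    telescopes. *)
Lemma sum_sq_abs_coef_extremal p m alpha n : (1 <= p)%nat -> 0 <= alpha < 1 ->
  sum_n (fun k => abs_coef p m (extremal_coef p m alpha) k ^ 2) n
    = 1 - (1 - alpha ^ 2) * alpha ^ (2 * n).
Proof.
intros Hp Ha. induction n as [|n IH].
- rewrite sum_O, abs_coef_extremal by assumption. refine (_ : @eq R _ _). simpl. ring.
- rewrite sum_n_S, IH, abs_coef_extremal by assumption.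
  replace (2 * S n)%nat with (2 + 2 * n)%nat by lia.
  rewrite pow_add, (Nat.mul_comm 2 n), pow_mult. refine (_ : @eq R _ _). ring.
Qed.

(** * Termwise bounds, equality cases and the theorem *)

Lemma sum_sq_abs_coef_le_1 p m a f n :
  (1 <= p)%nat -> classB f -> has_expansion p m a f ->
  sum_n (fun k => abs_coef p m a k ^ 2) n <= 1.
Proof.
intros Hp HB Hf. generalize (carlson_odd p m a f n Hp HB Hf).
generalize (Cmod_ge_0 (a (p * (2 * n + 1) + m)%nat)). unfold abs_coef. lra.
Qed.

Lemma even_bracket_le p m a f j :
  (1 <= p)%nat -> classB f -> has_expansion p m a f ->
  let B := abs_coef p m a in
  B (2 * S j)%nat + B (S j) ^ 2 / (1 + B 0%nat)
    + (sum_n (fun k => B k ^ 2) j - B 0%nat ^ 2) <= 1 - B 0%nat ^ 2.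
Proof.
intros Hp HB Hf B. generalize (carlson_even p m a f j Hp HB Hf).
unfold B, abs_coef. rewrite Nat.mul_0_r, Nat.add_0_l. lra.
Qed.

(** The first two terms are (1 - alpha^2) alpha^(2j) times alpha and 1 - alpha respectively;
    together they fill the deficit of the sum of squares from 1. *)
Lemma even_bracket_extremal p m alpha j : (1 <= p)%nat -> 0 <= alpha < 1 ->
  let B := abs_coef p m (extremal_coef p m alpha) in
  B (2 * S j)%nat + B (S j) ^ 2 / (1 + B 0%nat)
    + (sum_n (fun k => B k ^ 2) j - B 0%nat ^ 2) = 1 - B 0%nat ^ 2.
Proof.
intros Hp Ha B. unfold B. rewrite sum_sq_abs_coef_extremal by assumption.
replace (2 * S j)%nat with (S (2 * j + 1)) by lia.
rewrite !abs_coef_extremal, pow_add, (Nat.mul_comm 2 j), pow_mult by assumption.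
field. lra.
Qed.

(** The linear term (1 - alpha^2) alpha^(2j) is exactly the deficit of the sum of squares from 1. *)
Lemma odd_bracket_extremal p m alpha j : (1 <= p)%nat -> 0 <= alpha < 1 ->
  let B := abs_coef p m (extremal_coef p m alpha) in
  B (2 * j + 1)%nat + sum_n (fun k => B k ^ 2) j = 1.
Proof.
intros Hp Ha B. unfold B. rewrite sum_sq_abs_coef_extremal by assumption.
rewrite Nat.add_1_r, abs_coef_extremal by assumption. ring.
Qed.

Lemma pow_unit_interval p r : (1 <= p)%nat -> 0 <= r < 1 -> unit_interval (r ^ p).
Proof.
intros Hp Hr. split; [apply pow_le; lra|apply pow_lt_1_compat; [lra|lia]].
Qed.

Lemma abs_coef_0 p m a : abs_coef p m a 0 = Cmod (a m).
Proof. unfold abs_coef. now rewrite Nat.mul_0_r. Qed.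

Lemma even_rhs_series p m zeta a r :
  even_rhs p m zeta a r = abs_coef p m a 0 * zeta 0%nat (r ^ p) +
    Series (fun j => zeta (2 * S j)%nat (r ^ p) * (1 - abs_coef p m a 0 ^ 2)).
Proof. unfold even_rhs, sum_from. rewrite abs_coef_0, Series_scal_r. f_equal. apply Rmult_comm. Qed.

Lemma odd_rhs_series p zeta r :
  odd_rhs p zeta r = Series (fun j => zeta (2 * j + 1)%nat (r ^ p)).
Proof.
apply Series_ext. intros j. now replace (2 * (1 + j) - 1)%nat with (2 * j + 1)%nat by lia.
Qed.

Theorem lemma4 (zeta : nat -> R -> R) (p m : nat) (Hzeta : classF zeta)
    (Hp : (1 <= p)%nat) (Hm : (0 <= m <= p)%nat) :
  (* (i) *)
  ((forall (f : C -> C) (a : nat -> C),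
      classB f -> has_expansion p m a f ->
      forall r : R, 0 <= r < 1 ->
        summable_from 0 (even_lin p m zeta a r) /\
        summable_from 1 (even_sq p m zeta a r) /\
        even_lhs p m zeta a r <= even_rhs p m zeta a r) /\
   (* sharpness of (i) *)
   (forall alpha : R, 0 <= alpha < 1 ->
      exists (f : C -> C) (a : nat -> C),
        classB f /\ has_expansion p m a f /\ Cmod (a m) = alpha /\
        forall r : R, 0 <= r < 1 ->
          even_lhs p m zeta a r = even_rhs p m zeta a r)) /\
  (* (ii) *)
  ((forall (f : C -> C) (a : nat -> C),
      classB f -> has_expansion p m a f ->
      forall r : R, 0 <= r < 1 ->
        summable_from 1 (odd_lin p m zeta a r) /\
        summable_from 0 (odd_sq p m zeta a r) /\
        odd_lhs p m zeta a r <= odd_rhs p zeta r) /\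
   (* sharpness of (ii) *)
   (forall alpha : R, 0 <= alpha < 1 ->
      exists (f : C -> C) (a : nat -> C),
        classB f /\ has_expansion p m a f /\ Cmod (a m) = alpha /\
        forall r : R, 0 <= r < 1 ->
          odd_lhs p m zeta a r = odd_rhs p zeta r)).
Proof.
assert (Hz0 : forall r, 0 <= r < 1 -> forall n, 0 <= zeta n (r ^ p)).
{ intros r Hr n. apply Hzeta. now apply pow_unit_interval. }
assert (Hz : forall r, 0 <= r < 1 -> ex_series (fun n => zeta n (r ^ p))).
{ intros r Hr. apply (classF_ex_series zeta _ Hzeta). now apply pow_unit_interval. }
assert (Hev := fun f a HB Hf r Hr => even_lhs_series p m zeta a r (Hz0 r Hr) (Hz r Hr)
  (fun n => sum_sq_abs_coef_le_1 p m a f n Hp HB Hf)).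
assert (Hod := fun f a HB Hf r Hr => odd_lhs_series p m zeta a r (Hz0 r Hr) (Hz r Hr)
  (fun n => sum_sq_abs_coef_le_1 p m a f n Hp HB Hf)).
assert (Hcoef0 : forall alpha, 0 <= alpha < 1 -> Cmod (extremal_coef p m alpha m) = alpha).
{ intros alpha Ha. now rewrite <- abs_coef_0 with (p := p), abs_coef_extremal. }
split; split.
- intros f a HB Hf r Hr.
  destruct (Hev f a HB Hf r Hr) as [Hlin [Hsq [-> He]]].
  split; [exact Hlin|split; [exact Hsq|]]. rewrite even_rhs_series.
  (* The zeta_0 terms agree on both sides; the remaining series are compared term by term, which
     also requires nonnegative terms on the left. *)
  apply Rplus_le_compat_l, Series_le.
  + intros j. split.
    * apply Rmult_le_pos; [now apply Hz0|].
      assert (Hb := fun n => abs_coef_bounds p m a n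
        (fun n => sum_sq_abs_coef_le_1 p m a f n Hp HB Hf)).
      assert (Hs : abs_coef p m a 0 ^ 2 <= sum_n (fun k => abs_coef p m a k ^ 2) j).
      { induction j as [|j IH]; [rewrite sum_O; lra|].
        rewrite sum_n_S. generalize (pow2_ge_0 (abs_coef p m a (S j))). lra. }
      assert (Hd : 0 <= abs_coef p m a (S j) ^ 2 / (1 + abs_coef p m a 0)).
      { apply Rdiv_le_0_compat; [apply pow2_ge_0|generalize (Hb 0%nat); lra]. }
      generalize (Hb (2 * S j)%nat). lra.
    * apply Rmult_le_compat_l; [now apply Hz0|]. now apply (even_bracket_le p m a f).
  + now apply ex_series_scal_r.
- intros alpha Ha. exists (extremal p m alpha), (extremal_coef p m alpha).
  assert (HB := classB_extremal p m alpha Hp Ha).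
  assert (Hf := has_expansion_extremal p m alpha Hp Ha).
  split; [exact HB|split; [exact Hf|split; [now apply Hcoef0|]]]. intros r Hr.
  destruct (Hev _ _ HB Hf r Hr) as [_ [_ [-> _]]]. rewrite even_rhs_series.
  (* Equality holds in every bracket, hence for every r and every choice of weights. *)
  f_equal. apply Series_ext. intros j. f_equal. now apply even_bracket_extremal.
- intros f a HB Hf r Hr.
  destruct (Hod f a HB Hf r Hr) as [Hlin [Hsq [-> He]]].
  split; [exact Hlin|split; [exact Hsq|]]. rewrite odd_rhs_series.
  apply Series_le; [|exact He]. intros j.
  assert (H1 := carlson_odd p m a f j Hp HB Hf).
  assert (H2 := Hz0 r Hr (2 * j + 1)%nat).
  assert (H3 : 0 <= abs_coef p m a (2 * j + 1)) by apply Cmod_ge_0.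
  assert (H4 := sum_n_nonneg (fun k => abs_coef p m a k ^ 2) j (fun k => pow2_ge_0 _)).
  fold (abs_coef p m a (2 * j + 1)) in H1.
  change (sum_n _ j) with (sum_n (fun k => abs_coef p m a k ^ 2) j) in H1.
  split; [apply Rmult_le_pos; lra|].
  rewrite <- Rmult_1_r. apply Rmult_le_compat_l; [exact H2|exact H1].
- intros alpha Ha. exists (extremal p m alpha), (extremal_coef p m alpha).
  assert (HB := classB_extremal p m alpha Hp Ha).
  assert (Hf := has_expansion_extremal p m alpha Hp Ha).
  split; [exact HB|split; [exact Hf|split; [now apply Hcoef0|]]]. intros r Hr.
  destruct (Hod _ _ HB Hf r Hr) as [_ [_ [-> _]]]. rewrite odd_rhs_series.
  apply Series_ext. intros j. rewrite odd_bracket_extremal by assumption. ring.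
Qed.
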